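(* Let $G=\mathbb{Z}_2^3$ and let $\varepsilon\colon G\times G\to\mathbb{F}$ be a generic graded contraction. Then its support $S^\varepsilon:=\{\{g,h\}: g,h\in G,\ \varepsilon(g,h)\neq 0\}$ (identified with a set of unordered pairs of indices via $\{g_i,g_j\}\leftrightarrow\{i,j\}$) is a generalised nice set.
   Context: $\mathbb{F}$ is an algebraically closed field of characteristic zero. The elements of $G=\mathbb{Z}_2^3$ are labelled $g_0=(0,0,0)$, $g_1=(1,0,0)$, $g_2=(0,1,0)$, $g_3=(0,0,1)$, $g_4=(1,1,1)$, $g_5=(1,1,0)$, $g_6=(1,0,1)$, $g_7=(0,1,1)$; $I_0=\{0,\dots,7\}$ and $i*j\in I_0$ is defined by $g_i+g_j=g_{i*j}$. A map $\varepsilon\colon G\times G\to\mathbb{F}$ is a generic graded contraction if, for all $g,h,k\in G$, $\varepsilon(g,h)=\varepsilon(h,g)$ and $\varepsilon(g,h,k)=\varepsilon(k,g,h)$, where $\varepsilon(g,h,k):=\varepsilon(g,h+k)\varepsilon(h,k)$. $X_0$ is the set of all unordered pairs $\{i,j\}$ with $i,j\in I_0$ (possibly $i=j$). For $i,j,k\in I_0$ (possibly repeated), $P_{\{i,j,k\}}=\{\{i,j\},\{j,k\},\{k,i\},\{i,j*k\},\{j,k*i\},\{k,i*j\}\}$. A subset $T\subseteq X_0$ is a generalised nice set if for all $i,j,k\in I_0$, $\{i,j\},\{i*j,k\}\in T$ implies $P_{\{i,j,k\}}\subseteq T$. *)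

(* Defs.v *)
From HB Require Import structures.
From mathcomp Require Import all_boot all_order all_algebra.

Set Implicit Arguments.
Unset Strict Implicit.
Unset Printing Implicit Defensive.

Import GRing.Theory.
Local Open Scope ring_scope.

Notation Z2cube := ('Z_2 * 'Z_2 * 'Z_2)%type.

Definition label_seq : seq Z2cube :=
  [:: (0, 0, 0); (1, 0, 0); (0, 1, 0); (0, 0, 1);
      (1, 1, 1); (1, 1, 0); (1, 0, 1); (0, 1, 1)].

Definition label (i : 'I_8) : Z2cube := nth 0 label_seq i.

Lemma label_bij : bijective label.
Proof.
apply: inj_card_bij; last by rewrite !card_prod !card_ord.
move=> i j /eqP; rewrite /label nth_uniq //.
by move/eqP/val_inj.
Qed.

(* The default ord0 is never reached: labelM holds for all i and j. *)
Definition star (i j : 'I_8) : 'I_8 :=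
  odflt ord0 [pick k | label k == label i + label j].

Lemma labelM (i j : 'I_8) : label i + label j = label (star i j).
Proof.
rewrite /star; case: pickP => [k /eqP -> //|no].
have [f _ fK] := label_bij.
by have := no (f (label i + label j)); rewrite fK eqxx.
Qed.

Section Contractions.

Variable F : fieldType.
Implicit Type eps : Z2cube -> Z2cube -> F.

Definition ternary eps (g h k : Z2cube) : F := eps g (h + k) * eps h k.

Definition generic_graded_contraction eps : Prop :=
  forall g h k : Z2cube,
    eps g h = eps h g /\ ternary eps g h k = ternary eps k g h.

Definition pair_support eps : {set {set Z2cube}} :=
  [set [set gh.1; gh.2] | gh : Z2cube * Z2cube & eps gh.1 gh.2 != 0].

End Contractions.

(* An unordered pair {i, j} is the set [set i; j], a singleton when i = j. *)
Definition X0 : {set {set 'I_8}} :=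
  [set [set ij.1; ij.2] | ij : 'I_8 * 'I_8].

(* The pairs of indices whose image under i |-> g_i lies in S. *)
Definition index_pairs (S : {set {set Z2cube}}) : {set {set 'I_8}} :=
  [set A : {set 'I_8} | label @: A \in S].

Definition P_set (i j k : 'I_8) : {set {set 'I_8}} :=
  [set [set i; j]; [set j; k]; [set k; i];
       [set i; star j k]; [set j; star k i]; [set k; star i j]].

Definition generalised_nice_set (T : {set {set 'I_8}}) : Prop :=
  T \subset X0 /\
  forall i j k : 'I_8,
    [set i; j] \in T -> [set star i j; k] \in T -> P_set i j k \subset T.

(* Main.v *)
(* If e(i,j) and e(i+j,k) are nonzero, so is the ternary product
   e(k,i,j) = e(k,i+j) e(i,j), and with it its two cyclic rotations: their
   six factors are the values of e at the six pairs of P_{i,j,k}. *)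
Require Import Defs.
From mathcomp Require Import all_boot all_order all_algebra.

Set Implicit Arguments.
Unset Strict Implicit.
Unset Printing Implicit Defensive.

Import GRing.Theory.
Local Open Scope ring_scope.

Lemma eq_set2 (T : finType) (a b c d : T) :
  [set a; b] = [set c; d] -> (a = c /\ b = d) \/ (a = d /\ b = c).
Proof.
move/setP=> E.
(* Membership of each of the four points in both sets leaves only equalities between [a], [b] and
   [c], [d]. *)
have := E a; have := E b; have := E c; have := E d; rewrite !inE !eqxx /= ?orbT.
rewrite ![c == _]eq_sym ![d == _]eq_sym.
by do 4?case: eqP => [->|_] //=; auto; case: eqP; auto.
Qed.

(** An unordered pair fixes its ordered pair only up to a swap, and the symmetry of [eps] absorbs
    that swap. *)
Lemma mem_pair_support (F : fieldType) (eps : Z2cube -> Z2cube -> F)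
    (eps_sym : forall g h, eps g h = eps h g) (g h : Z2cube) :
  ([set g; h] \in pair_support eps) = (eps g h != 0).
Proof.
apply/imsetP/idP => [[[a b] /= nz /eq_set2[[-> ->]|[-> ->]]]|nz].
- by move: nz; rewrite inE.
- by move: nz; rewrite inE eps_sym.
- by exists (g, h); rewrite ?inE.
Qed.

Lemma mem_index_pairs (F : fieldType) (eps : Z2cube -> Z2cube -> F)
    (eps_sym : forall g h, eps g h = eps h g) (i j : 'I_8) :
  ([set i; j] \in index_pairs (pair_support eps)) =
    (eps (label i) (label j) != 0).
Proof. by rewrite inE imsetU1 imset_set1 mem_pair_support. Qed.

Lemma index_pairs_sub_X0 (F : fieldType) (eps : Z2cube -> Z2cube -> F) :
  index_pairs (pair_support eps) \subset X0.
Proof.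
have [f labelK fK] := label_bij.
apply/subsetP=> A; rewrite inE => /imsetP[[g h] _ /= EA].
apply/imsetP; exists (f g, f h) => //=.
(* As [label] is injective, the two index sets may be compared through their images. *)
apply: (imset_inj (can_inj labelK)).
by rewrite EA imsetU1 imset_set1 !fK.
Qed.

Theorem proposition3p4 (F : closedFieldType) (charF0 : [pchar F]%R =i pred0)
    (eps : Z2cube -> Z2cube -> F) (heps : generic_graded_contraction eps) :
  generalised_nice_set (index_pairs (pair_support eps)).
Proof.
(* The third element is arbitrary here; 0 merely instantiates it. *)
have eps_sym g h : eps g h = eps h g by have [] := heps g h 0.
have rot g h k : ternary eps g h k = ternary eps k g h by have [] := heps g h k.
split; first exact: index_pairs_sub_X0.
move=> i j k; rewrite !mem_index_pairs // -labelM => ij ijk.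
have kij : ternary eps (label k) (label i) (label j) != 0.
  by rewrite mulf_neq0 // eps_sym.
have jki := kij; rewrite rot in jki.
have ijk' := jki; rewrite rot in ijk'.
move: kij jki ijk'; rewrite /ternary !mulf_eq0 !negb_or.
move=> /andP[k_ij _] /andP[j_ki ki] /andP[i_jk jk].
(* The six pairs of [P_set], as oriented there, match the arguments of [eps] in [ij], [jk], [ki],
   [i_jk], [j_ki] and [k_ij]; [labelM] read backwards turns [star] into a sum. *)
apply/subsetP=> A; rewrite !(in_setU, in_set1) -!orbA.
by do 5?[case/predU1P => [->|]]; last move/eqP->;
  rewrite mem_index_pairs -?labelM.
Qed.
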